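(* Let $W$ be a tournament kernel on a probability space $(\mathcal S,\mu)$. The following are equivalent: (1) $W$ is transitive; (2) $W$ is acyclic, i.e. $t(\mathsf C_k,W)=0$ for all $k\ge3$; (3) $t(\mathsf C_3,W)=0$; (4) $W$ is equivalent to $W_T:[0,1]^2\to[0,1]$, $W_T(x,y)=\mathbb 1_{\{x\le y\}}$, on $[0,1]$ with Lebesgue measure; (5) $\int_{\mathcal S}\left(\int_{\mathcal S}W(x,y)\,d\mu(y)\right)^2d\mu(x)=\frac13$; (6) $t(\mathsf P_k,W)=\frac1{k!}$ for all $k\ge1$; (7) $t(\mathsf P_3,W)=\frac16$; (8) $t(\mathsf T_k,W)=\frac1{k!}$ for all $k\ge1$; (9) $t(\mathsf T_3,W)=\frac16$.
   Context: A tournament kernel on $(\mathcal S,\mu)$ is a measurable $W:\mathcal S^2\to[0,1]$ with $W(x,y)+W(y,x)=1$ for $\mu\times\mu$-a.e. $(x,y)$. It is transitive if $W(x,y)>0$ and $W(y,z)>0$ imply $W(x,z)=1$ for $\mu^3$-a.e. $(x,y,z)$. For a finite loopless digraph $F$ on $\{1,\dots,k\}$ without pairs of opposite edges, $t(F,W)=\int_{\mathcal S^k}\prod_{(i,j)\in E(F)}W(x_i,x_j)\prod_{i=1}^kd\mu(x_i)$. Two tournament kernels are equivalent if they have the same $t(F,\cdot)$ for all such $F$ (i.e. represent the same tournament limit). $\mathsf C_k$: edges $(1,2),\dots,(k-1,k),(k,1)$; $\mathsf P_k$: edges $(1,2),\dots,(k-1,k)$; $\mathsf T_k$: edges $(i,j)$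 for all $1\le i<j\le k$. *)

(* Defs.v *)
From HB Require Import structures.
From mathcomp Require Import all_boot all_order all_algebra.
From mathcomp Require Import all_classical all_reals all_analysis.

Set Implicit Arguments.
Unset Strict Implicit.
Unset Printing Implicit Defensive.

Import Order.TTheory GRing.Theory Num.Theory.
Import numFieldNormedType.Exports.

Local Open Scope classical_set_scope.
Local Open Scope ring_scope.

Section power_measure.
Context d (T : measurableType d) (R : realType) (P : probability T R).

Definition cons_pair n (p : T * n.-tuple T) : n.+1.-tuple T :=
  [tuple of p.1 :: p.2].

Lemma measurable_cons_pair n : measurable_fun setT (@cons_pair n).
Proof. exact: (measurable_cons measurable_fst measurable_snd). Qed.

HB.instance Definition _ n :=
  isMeasurableFun.Build _ _ _ _ (@cons_pair n) (@measurable_cons_pair n).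

(* The n-fold product measure on the library's product sigma-algebra of
   n.-tuple T; power_measure_box is its characteristic property. *)
Fixpoint power_measure n : probability (n.-tuple T) R :=
  if n is m.+1
  then distribution (P \x power_measure m)%E (@cons_pair m)
  else dirac [tuple].

Lemma power_measure_box n (A : 'I_n -> set T) : (forall i, measurable (A i)) ->
  power_measure n [set t | forall i, A i (tnth t i)] = (\prod_i P (A i))%E.
Proof.
elim: n A => [|n IHn] A mA.
  by rewrite big_ord0 /= diracE mem_set// => -[].
rewrite big_ord_recl -IHn// /= /distribution /pushforward.
rewrite -product_measure1E//.
  congr (_ _); apply/seteqP; split=> [[x t]/= At|[x t]/= [A0 At] i].
    split; first exact: (At ord0).
    by move=> i; have := At (lift ord0 i); rewrite tnthS.
  case: (unliftP ord0 i) => [j ->|-> //].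
  by rewrite tnthS; exact: At.
rewrite [X in measurable X](_ : _ =
    \bigcap_(i in setT) ((@tnth n T ^~ i) @^-1` (A (lift ord0 i)))).
  apply: fin_bigcap_measurable => // i _; rewrite -[X in measurable X]setTI.
  exact: measurable_tnth.
by apply/seteqP; split=> t /= At i; [move=> _; exact: At|exact: (At i)].
Qed.

End power_measure.

Section kernels.
Context d (T : measurableType d) (R : realType) (P : probability T R).
Implicit Types W : T * T -> R.

Record tournament_kernel W : Prop := TournamentKernel {
  tournament_kernel_measurable : measurable_fun setT W ;
  tournament_kernel_itv : forall p, 0 <= W p <= 1 ;
  tournament_kernel_ae :
    {ae (P \x P)%E, forall p, W (p.1, p.2) + W (p.2, p.1) = 1} }.

Definition transitive_kernel W : Prop :=
  {ae power_measure P 3, forall t : 3.-tuple T,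
    let x := tnth t 0 in let y := tnth t 1 in let z := tnth t 2 in
    0 < W (x, y) -> 0 < W (y, z) -> W (x, z) = 1}.

Definition hom_density k (F : rel 'I_k) W : \bar R :=
  (\int[power_measure P k]_x
    (\prod_(e : 'I_k * 'I_k | F e.1 e.2) W (tnth x e.1, tnth x e.2))%:E)%E.

End kernels.

Definition oriented_graph k (F : rel 'I_k) : Prop :=
  (forall i, ~~ F i i) /\ (forall i j, ~~ (F i j && F j i)).

Definition equivalent_kernels (R : realType)
    d1 (T1 : measurableType d1) (P1 : probability T1 R) (W1 : T1 * T1 -> R)
    d2 (T2 : measurableType d2) (P2 : probability T2 R) (W2 : T2 * T2 -> R) :=
  forall k (F : rel 'I_k), oriented_graph F ->
    hom_density P1 F W1 = hom_density P2 F W2.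

(* Vertices are 0, ..., k - 1, and ordS is the successor modulo k. *)
Definition cycle_graph k : rel 'I_k := fun i j => j == ordS i.
Definition path_graph k : rel 'I_k := fun i j => j == i.+1 :> nat.
Definition transitive_tournament k : rel 'I_k := fun i j => (i < j)%N.

Definition acyclic_kernel d (T : measurableType d) (R : realType)
    (P : probability T R) (W : T * T -> R) : Prop :=
  forall k, (3 <= k)%N -> hom_density P (@cycle_graph k) W = 0%E.

Definition unit_interval (R : realType) : Type := {x : R | 0 <= x <= 1}.

HB.instance Definition _ (R : realType) := Choice.on (unit_interval R).

Lemma unit_interval0 (R : realType) : 0 <= (0 : R) <= 1.
Proof. by rewrite lexx ler01. Qed.

HB.instance Definition _ (R : realType) :=
  isPointed.Build (unit_interval R) (exist _ 0 (@unit_interval0 R)).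

Definition unit_val (R : realType) (x : unit_interval R) : measurableTypeR R :=
  sval x.

(* [0, 1] with its Borel sets, i.e. the traces of the Borel sets of R. *)
Notation borel_unit_interval R := (g_sigma_algebra_preimageType (@unit_val R)).

Section lebesgue_unit_interval.
Context (R : realType).
Implicit Types A : set (borel_unit_interval R).

Definition lebesgue_unit A : \bar R := lebesgue_measure (@unit_val R @` A).

Lemma unit_val_inj : injective (@unit_val R).
Proof. by move=> x y /val_inj. Qed.

Lemma range_unit_val : range (@unit_val R) = `[0 : R, 1]%classic.
Proof.
apply/seteqP; split=> [_ [[x x01] _ <-]|x] /=; rewrite in_itv//= => x01.
by exists (exist _ x x01).
Qed.

Lemma measurable_image_unit_val A :
  measurable A -> measurable (@unit_val R @` A).
Proof.
move=> [B mB <-]; rewrite [X in measurable X](_ : _ = B `&` `[0 : R, 1]%classic).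
  by apply: measurableI => //; exact: measurable_itv.
rewrite -range_unit_val setTI; apply/seteqP; split=> [_ [x Bx <-]|].
  by split=> //; exists x.
by move=> _ [/[swap] -[x _ <-] Bx]; exists x.
Qed.

Let lebesgue_unit0 : lebesgue_unit set0 = 0%E.
Proof. by rewrite /lebesgue_unit image_set0 measure0. Qed.

Let lebesgue_unit_ge0 A : (0 <= lebesgue_unit A)%E.
Proof. exact: measure_ge0. Qed.

Let lebesgue_unit_sigma_additive : semi_sigma_additive lebesgue_unit.
Proof.
move=> F mF tF mUF; rewrite /lebesgue_unit image_bigcup.
apply: measure_semi_sigma_additive.
- by move=> i; exact: measurable_image_unit_val.
- apply/trivIsetP => i j _ _ ij.
  move/trivIsetP : tF => /(_ i j Logic.I Logic.I ij) FF0.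
  rewrite -subset0 => _ [[x Fx <-] [y Fy /unit_val_inj yx]].
  by have : set0 x by rewrite -FF0; split=> //; rewrite -yx.
- by rewrite -image_bigcup; exact: measurable_image_unit_val.
Qed.

HB.instance Definition _ := isMeasure.Build _ _ _ lebesgue_unit
  lebesgue_unit0 lebesgue_unit_ge0 lebesgue_unit_sigma_additive.

Let lebesgue_unitT : lebesgue_unit setT = 1%E.
Proof.
by rewrite /lebesgue_unit range_unit_val lebesgue_measure_itv/= lte01 oppr0 adde0.
Qed.

HB.instance Definition _ :=
  Measure_isProbability.Build _ _ _ lebesgue_unit lebesgue_unitT.

Definition kernel_WT (p : borel_unit_interval R * borel_unit_interval R) : R :=
  (unit_val p.1 <= unit_val p.2)%R%:R.

End lebesgue_unit_interval.

(* Main.v *)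
(** If [W] is transitive then almost every [k]-tuple of points is linearly
    ordered by [W]: outside a null set the values [W (x_i, x_j)] are [0] or [1]
    and form a transitive tournament, i.e. they come from a unique permutation.
    By symmetry of the product measure all [k!] orders are equally likely, so
    [t(F, W)] is the number of linear extensions of [F] divided by [k!],
    whatever the transitive kernel is; [W_T] is one of them.

    Conversely, summing over the orientation of the missing edge on three
    vertices gives [t(P_3) = t(T_3) + t(C_3)], [D = 2 t(T_3)] and
    [t(P_3) + D = 1/2], where [D] is the integral of the squared out-degree, so
    each of the three-vertex conditions says [t(C_3) = 0].  Then
    [W (x, y) W (y, z) W (z, x) = 0] almost everywhere, which is transitivity. *)

Require Import Defs.
From HB Require Import structures.
From mathcomp Require Import all_boot all_order all_algebra all_fingroup.
From mathcomp Require Import all_classical all_reals all_analysis.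
From mathcomp Require Import measurable_realfun lra zify.

Set Implicit Arguments.
Unset Strict Implicit.
Unset Printing Implicit Defensive.

Import Order.TTheory GRing.Theory Num.Theory.

(** * Finite linear orders, encoded by permutations *)

Section linear_orders.
Variable k : nat.
Implicit Types (p q : 'S_k) (i j l : 'I_k) (F r : rel 'I_k).

(** [p] carries this set bijectively onto the ordinals below [p i]. *)
Lemma card_perm_lt p i : #|[set j | p j < p i]| = p i.
Proof.
have le_pi : p i <= k by exact: ltnW.
have widen_inj : injective (widen_ord le_pi) by move=> ? ? [/val_inj].
rewrite -(card_imset _ (@perm_inj _ p)) -[RHS]card_ord -(card_imset _ widen_inj).
apply: eq_card => l; apply/imsetP/imsetP => [[j]|[j _ ->]].
  by rewrite inE => ji ->; exists (Ordinal ji) => //; exact/val_inj.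
by exists ((p^-1)%g (widen_ord le_pi j)); rewrite ?inE permKV/=.
Qed.

(** [p i] is the number of vertices placed before [i], so it can be read off from the
    comparisons. *)
Lemma perm_lt_inj p q :
  (forall i j, i != j -> (p i < p j) = (q i < q j)) -> p = q.
Proof.
move=> pq; apply/permP => i; apply/val_inj; rewrite /= -(card_perm_lt p) -(card_perm_lt q).
apply: eq_card => j; rewrite !inE.
by have [->|/pq//] := eqVneq j i; rewrite !ltnn.
Qed.

(** The rank of [i] is its number of predecessors. By transitivity, an edge from [i] to [j] makes
    the predecessors of [i] a proper subset of those of [j], so distinct vertices have distinct
    ranks. *)
Lemma tournament_rank r :
  (forall i j, i != j -> r i j = ~~ r j i) ->
  (forall i j l, uniq [:: i; j; l] -> r i j -> r j l -> r i l) ->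
  exists p, forall i j, i != j -> r i j = (p i < p j).
Proof.
move=> r_total r_trans.
pose below i := [set j | (j != i) && r j i].
have below_lt i : #|below i| < k.
  rewrite -[X in _ < X]card_ord; apply/proper_card/properP; split.
    exact/fintype.subsetP.
  by exists i; rewrite // inE eqxx.
have below_proper i j : i != j -> r i j -> #|below i| < #|below j|.
  move=> ij rij; apply/proper_card/properP; split.
    apply/fintype.subsetP => l; rewrite !inE => /andP[li rli].
    have lj : l != j by apply: contraTneq rij => <-; rewrite r_total 1?eq_sym// rli.
    by rewrite lj (r_trans l i j)//= !inE negb_or li lj ij.
  exists i; rewrite !inE ?eqxx// ij rij//.
pose rank i := Ordinal (below_lt i).
have rank_lt i j : i != j -> r i j = (rank i < rank j).
  move=> ij; have [rij|] := boolP (r i j).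
    by apply/esym; exact: below_proper.
  rewrite r_total// negbK => rji; apply/esym/negbTE; rewrite -leqNgt ltnW//.
  by apply: below_proper rji; rewrite eq_sym.
have rank_inj : injective rank.
  move=> i j /(congr1 val) /= eij; apply/eqP/negP => /negP ij.
  have := rank_lt i j ij; rewrite r_total// rank_lt 1?eq_sym//= eij.
  by rewrite ltnn.
by exists (perm rank_inj) => i j ij; rewrite !permE rank_lt.
Qed.

Definition linear_extension F p := [forall i, forall j, F i j ==> (p i < p j)].

Lemma linear_extensionP F p :
  reflect (forall i j, F i j -> p i < p j) (linear_extension F p).
Proof.
apply: (iffP idP) => [/forallP Fp i j|Fp].
  by move: (Fp i) => /forallP/(_ j)/implyP.
by apply/forallP => i; apply/forallP => j; apply/implyP/Fp.
Qed.

(** Increasing along consecutive vertices makes [p] strictly increasing, and only the identity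
    is. *)
Lemma linear_extension_succ F p :
  (forall i j, j = i.+1 :> nat -> F i j) -> linear_extension F p -> p = 1%g.
Proof.
move=> Fsucc /linear_extensionP Fp.
(* Induction on the gap [n.+1]; a gap of one is a single edge of [F]. *)
have p_lt n i j : j = i + n.+1 :> nat -> p i < p j.
  elim: n j => [|n IHn] j jE; first by apply/Fp/Fsucc; rewrite jE addn1.
  have lt_in : i + n.+1 < k by rewrite (leq_ltn_trans _ (ltn_ord j))// jE; lia.
  apply: (ltn_trans (IHn (Ordinal lt_in) erefl)).
  by apply/Fp/Fsucc; rewrite jE /=; lia.
have p_mono i j : i < j -> p i < p j.
  by move=> ij; apply: (p_lt (j - i.+1)); lia.
apply: perm_lt_inj => i j ij; rewrite !perm1.
case: (ltngtP i j) => [/p_mono ->//|/p_mono|/val_inj/eqP].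
  by rewrite ltnNge => /negbTE; lia.
by rewrite (negbTE ij).
Qed.

(** Serves both paths and transitive tournaments, whose densities thus have numerator [1]. *)
Lemma card_linear_extension_succ F :
  (forall i j, j = i.+1 :> nat -> F i j) -> (forall i j, F i j -> i < j) ->
  #|[set p | linear_extension F p]| = 1.
Proof.
move=> Fsucc Flt; rewrite (_ : [set p | _] = [set 1%g]) ?cards1//.
apply/setP => p; rewrite !inE; apply/idP/eqP; first exact: linear_extension_succ.
by move=> ->; apply/linear_extensionP => i j; rewrite !perm1; exact: Flt.
Qed.

(** The vertex in the last position still has an outgoing edge. *)
Lemma linear_extension_cycleF p : 0 < k ->
  linear_extension (fun i j => j == ordS i) p = false.
Proof.
move=> k0; apply/negbTE/linear_extensionP => Fp.
have k1 : k.-1 < k by rewrite prednK.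
have := Fp ((p^-1)%g (Ordinal k1)) _ (eqxx _); rewrite permKV /=.
by have := ltn_ord (p (ordS ((p^-1)%g (Ordinal k1)))); lia.
Qed.

End linear_orders.

Local Open Scope classical_set_scope.
Local Open Scope ring_scope.

(** * Boxes generate the product sigma-algebra and determine finite measures *)

Section tuple_boxes.
Context d (T : measurableType d) (n : nat).

Definition box (A : 'I_n -> set T) : set (n.-tuple T) :=
  [set t | forall i, A i (tnth t i)].

Lemma measurable_box (A : 'I_n -> set T) :
  (forall i, measurable (A i)) -> measurable (box A).
Proof.
move=> mA; rewrite (_ : box A =
    \bigcap_(i in setT) ((@tnth n T ^~ i) @^-1` (A i))).
  apply: fin_bigcap_measurable => // i _; rewrite -[X in measurable X]setTI.
  exact: measurable_tnth.
by apply/seteqP; split=> t /= At i; [move=> _; exact: At|exact: (At i)].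
Qed.

Definition boxes : set (set (n.-tuple T)) :=
  [set box A | A in [set A | forall i, measurable (A i)]].

Lemma setI_closed_boxes : setI_closed boxes.
Proof.
move=> _ _ [A mA <-] [B mB <-]; exists (fun i => A i `&` B i).
  by move=> i; apply: measurableI; [exact: mA|exact: mB].
apply/seteqP; split=> [t /= ABt|t [At Bt] i]; last by split; [exact: At|exact: Bt].
by split=> i; case: (ABt i).
Qed.

(** The preimage of a set under one coordinate is a box whose other sides are full. *)
Lemma measurable_tupleE : @measurable _ (n.-tuple T) = <<s boxes >>.
Proof.
apply/seteqP; split; last first.
  apply: smallest_sub; first exact: sigma_algebra_measurable.
  by move=> _ [A mA <-]; exact: measurable_box.
apply: smallest_sub; first exact: smallest_sigma_algebra.
rewrite -bigcup_seq /=; apply: bigcup_sub => i _ _ [A mA <-].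
apply: sub_sigma_algebra; exists (fun j => if j == i then A else setT).
  by move=> j; case: ifP.
rewrite setTI; apply/seteqP; split=> [t /(_ i)|t At j] /=.
  by rewrite eqxx.
by case: eqP => // ->.
Qed.

Lemma tuple_measure_unique (R : realType)
    (m1 m2 : {finite_measure set (n.-tuple T) -> \bar R}) :
  (forall A, (forall i, measurable (A i)) -> m1 (box A) = m2 (box A)) ->
  forall X, measurable X -> m1 X = m2 X.
Proof.
move=> m12; apply: (measure_unique boxes (fun=> setT)) => //.
- exact: measurable_tupleE.
- exact: setI_closed_boxes.
- move=> _; exists (fun=> setT) => //.
  by apply/seteqP; split.
- by rewrite bigcup_const.
- by move=> _ [A mA <-]; exact: m12.
- by move=> _; rewrite -ge0_fin_numE// fin_num_measure.
Qed.

End tuple_boxes.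

(** * Coordinate selections under the product measure *)

Section reindex.
Context d (T : measurableType d) (R : realType) (P : probability T R).
Variables m n : nat.

Definition reindex (h : 'I_m -> 'I_n) (t : n.-tuple T) : m.-tuple T :=
  [tuple tnth t (h i) | i < m].

Lemma tnth_reindex h t i : tnth (reindex h t) i = tnth t (h i).
Proof. by rewrite tnth_mktuple. Qed.

Lemma measurable_reindex h : measurable_fun setT (reindex h).
Proof.
apply/measurable_fun_tnthP => i.
rewrite (_ : _ \o _ = fun t => tnth t (h i)); first exact: measurable_tnth.
by apply/funext => t /=; rewrite tnth_reindex.
Qed.

HB.instance Definition _ h :=
  isMeasurableFun.Build _ _ _ _ (reindex h) (measurable_reindex h).

(** Distinct coordinates are independent with law [P], and boxes suffice as test sets. A bijective
    [h] gives permutation invariance, other injections give marginals. *)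
Lemma power_measure_reindex h (A : set (m.-tuple T)) : injective h -> measurable A ->
  power_measure P n (reindex h @^-1` A) = power_measure P m A.
Proof.
move=> hinj; move: A.
apply: (@tuple_measure_unique _ T m R (distribution (power_measure P n) (reindex h))
  (power_measure P m)) => A mA.
transitivity (\prod_i P (A i))%E; last exact/esym/power_measure_box.
change (power_measure P n (reindex h @^-1` box A) = \prod_i P (A i))%E.
(* The pulled-back box has side [A i] at [h i], well defined by injectivity, and full sides
   elsewhere, which contribute factors [1]. *)
pose B l := if [pick i | h i == l] is Some i then A i else setT.
have Bh i : B (h i) = A i.
  rewrite /B; case: pickP => [j /eqP/hinj -> //|/(_ i)]; by rewrite eqxx.
have mB l : measurable (B l) by rewrite /B; case: pickP.
rewrite (_ : _ @^-1` _ = [set t | forall i, B i (tnth t i)]); last first.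
  apply/seteqP; split=> t /= At i.
    by rewrite /B; case: pickP => [j /eqP <-|//]; rewrite -tnth_reindex; exact: At.
  by rewrite tnth_reindex -Bh; exact: At.
transitivity (\prod_i P (B i))%E; first exact: power_measure_box.
rewrite (bigID (mem (codom h)))/= [X in (_ * X)%E]big1 ?mule1; last first.
  move=> l hl; rewrite /B; case: pickP => [i /eqP hi|_]; last by rewrite probability_setT.
  by rewrite -hi codom_f in hl.
rewrite -big_uniq/=; last by rewrite map_inj_uniq ?enum_uniq.
by rewrite big_image/=; apply: eq_bigr => i _; rewrite Bh.
Qed.

Lemma ae_reindex h (Q : m.-tuple T -> Prop) : injective h ->
  {ae power_measure P m, forall t, Q t} ->
  {ae power_measure P n, forall t, Q (reindex h t)}.
Proof.
move=> hinj [N [mN N0 QN]]; exists (reindex h @^-1` N); split.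
- by rewrite -[X in measurable X]setTI; exact: measurable_reindex.
- by rewrite power_measure_reindex.
- by move=> t /= Qt; exact: QN.
Qed.

Lemma ge0_integral_reindex h (f : m.-tuple T -> \bar R) : injective h ->
  measurable_fun [set: m.-tuple T] f -> (forall t, 0 <= f t)%E ->
  (\int[power_measure P n]_t f (reindex h t) = \int[power_measure P m]_t f t)%E.
Proof.
move=> hinj mf f0.
rewrite -(@ge0_integral_distribution _ _ _ _ _ _ (reindex h : {RV _ >-> _}))//.
apply: eq_measure_integral => A mA _.
exact: power_measure_reindex.
Qed.

(** Two distinct coordinates are independent, which is checked on rectangles. This carries null sets
    of pairs to null sets of tuples. *)
Lemma power_measure_pair (i j : 'I_n) (B : set (T * T)) : i != j -> measurable B ->
  power_measure P n [set t | B (tnth t i, tnth t j)] = (P \x P)%E B.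
Proof.
move=> ij mB.
have mij : measurable_fun [set: n.-tuple T] (fun t => (tnth t i, tnth t j)).
  by apply: measurable_fun_pair; exact: measurable_tnth.
pose X : {RV power_measure P n >-> (T * T)%type} :=
  HB.pack (fun t : n.-tuple T => (tnth t i, tnth t j))
   (isMeasurableFun.Build _ _ _ _ _ mij).
apply/esym; suff XE A B' : measurable A -> measurable B' ->
    distribution (power_measure P n) X (A `*` B') = (P A * P B')%E.
  exact: (@product_measure_unique _ _ _ _ _ P P
    (distribution (power_measure P n) X) XE B mB).
clear B mB; move: B' => B mA mB.
change (power_measure P n (X @^-1` (A `*` B)) = P A * P B)%E.
pose C l := if l == i then A else if l == j then B else setT.
have mC l : measurable (C l) by rewrite /C; case: ifP => // _; case: ifP.
have ji : (j == i) = false by rewrite eq_sym (negbTE ij).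
rewrite (_ : _ @^-1` _ = [set t | forall l, C l (tnth t l)]); last first.
  apply/seteqP; split=> [t /= [At Bt] l|t Ct].
    by rewrite /C; case: eqP => [->//|_]; case: eqP => [->|].
  by split; [have := Ct i|have := Ct j]; rewrite /C eqxx ?ji.
rewrite power_measure_box// (bigD1 i)//= (bigD1 j) ?ji//= big1 ?mule1.
  by rewrite /C !eqxx ji.
by move=> l /andP[/negbTE li /negbTE lj]; rewrite /C li lj probability_setT.
Qed.

Lemma ae_pair (i j : 'I_n) (Q : T * T -> Prop) : i != j ->
  {ae (P \x P)%E, forall p, Q p} ->
  {ae power_measure P n, forall t, Q (tnth t i, tnth t j)}.
Proof.
move=> ij [N [mN N0 QN]]; exists [set t | N (tnth t i, tnth t j)]; split.
- rewrite -[X in measurable X]setTI.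
  have mij : measurable_fun [set: n.-tuple T] (fun t => (tnth t i, tnth t j)).
    by apply: measurable_fun_pair; exact: measurable_tnth.
  exact: mij.
- by rewrite power_measure_pair.
- by move=> t /= Qt; exact: QN.
Qed.

End reindex.

(** * Tonelli for tuples, and squares of integrals *)

Section iterated_integrals.
Context d (T : measurableType d) (R : realType) (P : probability T R).
Local Open Scope ereal_scope.

Lemma ge0_integral_power_measureS n (f : n.+1.-tuple T -> \bar R) :
  measurable_fun [set: n.+1.-tuple T] f -> (forall t, 0 <= f t) ->
  \int[power_measure P n.+1]_t f t =
  \int[P]_x \int[power_measure P n]_t f [tuple of x :: t].
Proof.
move=> mf f0.
rewrite (@ge0_integral_distribution _ _ _ _ _ _ (@cons_pair _ T n))//.
rewrite fubini_tonelli1//; last by move=> p; exact: f0.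
exact: (measurableT_comp mf (@measurable_cons_pair _ T n)).
Qed.

(** The square of the inner integral is an integral over two independent copies of the second
    variable. It serves for the out-degree and for the product of [W (x, y)] and [W (y, x)]. *)
Lemma integral_sqr (g : T * T -> R) : measurable_fun setT g ->
  (forall p, 0 <= g p)%R ->
  \int[P]_x ((\int[P]_y (g (x, y))%:E) ^+ 2) =
  \int[power_measure P 3]_t
    (g (tnth t 0, tnth t 1) * g (tnth t 0, tnth t 2%R))%:E.
Proof.
move=> mg g0.
have g0E p : 0 <= (g p)%:E by rewrite lee_fin.
have mgx x : measurable_fun setT (fun y => (g (x, y))%:E).
  by apply/measurable_EFinP; exact: measurableT_comp.
have mt n (i j : 'I_n) :
    measurable_fun [set: n.-tuple T] (fun t => g (tnth t i, tnth t j)).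
  by apply: measurableT_comp => //; apply: measurable_fun_pair; exact: measurable_tnth.
have mxt n (i : 'I_n) x : measurable_fun [set: n.-tuple T] (fun t => g (x, tnth t i)).
  by apply: measurableT_comp => //; apply: measurable_fun_pair => //; exact: measurable_tnth.
rewrite ge0_integral_power_measureS//; last 2 first.
- by apply/measurable_EFinP; apply: measurable_funM; exact: mt.
- by move=> t; rewrite lee_fin mulr_ge0.
apply: eq_integral => x _.
have -> : (fun t : 2.-tuple T => (g (tnth [tuple of x :: t] 0, tnth [tuple of x :: t] 1) *
    g (tnth [tuple of x :: t] 0, tnth [tuple of x :: t] 2%R))%:E) =
  (fun t : 2.-tuple T => (g (x, tnth t 0) * g (x, tnth t 1))%:E).
  by apply/funext => t; rewrite !(tnth_nth x).
rewrite ge0_integral_power_measureS//; last 2 first.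
- by apply/measurable_EFinP; apply: measurable_funM; exact: mxt.
- by move=> t; rewrite lee_fin mulr_ge0.
have E y : \int[power_measure P 1]_t
    (g (x, tnth [tuple of y :: t] 0) * g (x, tnth [tuple of y :: t] 1))%:E =
    (g (x, y))%:E * \int[P]_z (g (x, z))%:E.
  have -> : (fun t : 1.-tuple T => (g (x, tnth [tuple of y :: t] 0) *
      g (x, tnth [tuple of y :: t] 1))%:E) =
      (fun t : 1.-tuple T => (g (x, y))%:E * (g (x, tnth t 0))%:E).
    by apply/funext => t; rewrite !(tnth_nth x).
  have mE : measurable_fun [set: 1.-tuple T] (fun t => (g (x, tnth t 0%R))%:E).
    by apply/measurable_EFinP; exact: mxt.
  rewrite (ge0_integralZl _ measurableT mE)//.
  congr (_ * _); rewrite ge0_integral_power_measureS//.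
  apply: eq_integral => z _.
  under eq_integral do rewrite (tnth_nth x)/=.
  (* What remains is a constant over the empty tuple, where the measure has total mass [1]. *)
  transitivity ((g (x, z))%:E * power_measure P 0 setT).
    exact: integral_cst.
  by rewrite probability_setT mule1.
transitivity (\int[P]_y ((g (x, y))%:E * \int[P]_z (g (x, z))%:E)); last first.
  by apply: eq_integral => y _; exact/esym/E.
by rewrite ge0_integralZr ?expe2//; exact: integral_ge0.
Qed.

End iterated_integrals.

Lemma ge0_integral_eq0P d (T : measurableType d) (R : realType)
    (mu : {measure set T -> \bar R}) (f : T -> \bar R) :
  measurable_fun setT f -> (forall x, 0 <= f x)%E ->
  (\int[mu]_x f x = 0)%E <-> {ae mu, forall x, f x = 0%E}.
Proof.
move=> mf f0.
have -> : (\int[mu]_x f x = \int[mu]_x `|f x|)%E.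
  by apply: eq_integral => x _; rewrite gee0_abs.
by rewrite ae_eq_integral_abs//; split; apply: filterS => x // /(_ I).
Qed.

(** * Almost sure properties of sampled tournaments *)

Section tournament_kernels.
Context d (T : measurableType d) (R : realType) (P : probability T R).
Variable W : T * T -> R.
Hypothesis hW : tournament_kernel P W.

Let mW : measurable_fun setT W := tournament_kernel_measurable hW.

Lemma kernel_ge0 p : 0 <= W p.
Proof. by have /andP[] := tournament_kernel_itv hW p. Qed.

Lemma measurable_kernel_tnth k (i j : 'I_k) :
  measurable_fun [set: k.-tuple T] (fun t => W (tnth t i, tnth t j)).
Proof.
by apply: measurableT_comp => //; apply: measurable_fun_pair;
   exact: measurable_tnth.
Qed.

(** There are finitely many pairs, so their exceptional null sets can be united. *)
Lemma kernel_antisym_ae k :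
  {ae power_measure P k, forall t, forall i j, i != j ->
    W (tnth t i, tnth t j) + W (tnth t j, tnth t i) = 1}.
Proof.
apply: filter_forall => i; apply: filter_forall => j.
have [->|ij] := eqVneq i j; first by apply: aeW.
have := ae_pair ij (tournament_kernel_ae hW).
by apply: filterS.
Qed.

(** * Densities in a transitive kernel by counting linear extensions *)

Section transitive.
Hypothesis Wtr : transitive_kernel P W.

(** Three distinct coordinates have the law [power_measure P 3], and only finitely many null sets
    are discarded. *)
Lemma transitive_kernel_ae k :
  {ae power_measure P k, forall t, forall i j l : 'I_k, uniq [:: i; j; l] ->
    0 < W (tnth t i, tnth t j) -> 0 < W (tnth t j, tnth t l) ->
    W (tnth t i, tnth t l) = 1}.
Proof.
apply: filter_forall => i; apply: filter_forall => j; apply: filter_forall => l.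
have [ijl|] := boolP (uniq _); last by move=> _; exact: aeW.
pose h (a : 'I_3) := tnth [tuple i; j; l] a.
have hinj : injective h by apply/tuple_uniqP.
have := ae_reindex hinj Wtr; apply: filterS => t /=.
by rewrite !tnth_reindex.
Qed.

(* With [g (x, y) = W (x, y) W (y, x)], transitivity through [x] gives
   [g (x, y) g (x, z) = 0] almost everywhere, i.e. the square of the integral of
   [g (x, _)] vanishes for almost every [x]. *)
Lemma transitive_kernel_01 : {ae (P \x P)%E, forall p, W p = 0 \/ W p = 1}.
Proof.
pose g (p : T * T) := W (p.1, p.2) * W (p.2, p.1).
have g0 p : 0 <= g p by rewrite mulr_ge0// kernel_ge0.
have mg : measurable_fun setT g.
  apply: measurable_funM; apply: measurableT_comp => //.
    exact: measurable_fun_pair.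
  exact: measurable_fun_pair.
have mg_tnth (i j : 'I_3) :
    measurable_fun [set: 3.-tuple T] (fun t => g (tnth t i, tnth t j)).
  by apply: measurable_funM; exact: measurable_kernel_tnth.
have mgg : measurable_fun [set: 3.-tuple T] (fun t =>
    (g (tnth t 0, tnth t 1) * g (tnth t 0, tnth t 2))%:E).
  by apply/measurable_EFinP; apply: measurable_funM; exact: mg_tnth.
have sqr0 : (\int[P]_x ((\int[P]_y (g (x, y))%:E) ^+ 2) = 0)%E.
  rewrite (integral_sqr P mg g0); apply/ge0_integral_eq0P => //.
    by move=> t; rewrite lee_fin mulr_ge0.
  apply: filterS2 (kernel_antisym_ae 3) (transitive_kernel_ae 3) => t anti tr.
  have kpos q : W q = 0 \/ 0 < W q.
    by have := kernel_ge0 q; rewrite le_eqVlt => /predU1P[<-|]; [left|right].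
  congr (_%:E); rewrite /g /=.
  case: (kpos (tnth t 0, tnth t 1)) => [->|W01]; first by rewrite !mul0r.
  case: (kpos (tnth t 1, tnth t 0)) => [->|W10]; first by rewrite !(mulr0, mul0r).
  case: (kpos (tnth t 0, tnth t 2)) => [->|W02]; first by rewrite !(mulr0, mul0r).
  case: (kpos (tnth t 2, tnth t 0)) => [->|W20]; first by rewrite !(mulr0, mul0r).
  (* If all four values are positive, transitivity through vertex [0] gives the value [1] in both
     directions between vertices [1] and [2], but these must sum to [1]. *)
  have := anti 1 2 isT.
  by rewrite (tr 1 0 2)// (tr 2 0 1)// => ?; exfalso; lra.
have mgE : measurable_fun setT (EFin \o g) by exact/measurable_EFinP.
have g0E p : (0 <= (EFin \o g) p)%E by rewrite lee_fin.
have mG := @measurable_fun_fubini_tonelli_F _ _ _ _ _ P _ mgE g0E.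
have G0 x : (0 <= fubini_F P (EFin \o g) x)%E by apply: integral_ge0 => y _.
have : {ae (P \x P)%E, forall p, (g p)%:E = 0%E}.
  apply/ge0_integral_eq0P => //.
  rewrite (fubini_tonelli1 _ mgE)//; apply/ge0_integral_eq0P => //.
  move/ge0_integral_eq0P : sqr0.
  have mG2 : measurable_fun setT (fun x => fubini_F P (EFin \o g) x ^+ 2)%E.
    under eq_fun do rewrite expe2.
    exact: emeasurable_funM.
  move=> /(_ mG2 (fun x => sqre_ge0 _)); apply: filterS => x /eqP.
  by rewrite expe2 mule_eq0 orbb => /eqP.
apply: filterS2 (tournament_kernel_ae hW) => -[x y] /= anti [/eqP].
rewrite mulf_eq0 => /orP[/eqP|/eqP] W0; [by left|right].
by rewrite -anti W0 addr0.
Qed.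

Definition order_event k (p : 'S_k) : set (k.-tuple T) :=
  [set t | forall i j, i != j -> W (tnth t i, tnth t j) = (p i < p j)%N%:R].

Lemma measurable_order_event k (p : 'S_k) : measurable (order_event p).
Proof.
rewrite (_ : order_event p = \bigcap_(e in [set e : 'I_k * 'I_k | e.1 != e.2])
    ((fun t => W (tnth t e.1, tnth t e.2)) @^-1` [set (p e.1 < p e.2)%N%:R])).
  apply: fin_bigcap_measurable => // e _; rewrite -[X in measurable X]setTI.
  exact: measurable_kernel_tnth.
apply/seteqP; split=> [t pt [i j] /= ij|t pt i j ij]; first exact: pt.
exact: (pt (i, j)).
Qed.

Lemma order_event_inj k (p q : 'S_k) t :
  order_event p t -> order_event q t -> p = q.
Proof.
move=> pt qt; apply: perm_lt_inj => i j ij.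
have /eqP : (p i < p j)%N%:R = (q i < q j)%N%:R :> R by rewrite -pt// -qt.
by rewrite eqr_nat; case: (p i < p j)%N; case: (q i < q j)%N.
Qed.

(** Off a null set the values are [0] or [1], so the pairs of value [1] form a transitive
    tournament, and [tournament_rank] supplies the order. *)
Lemma order_event_ae k :
  {ae power_measure P k, forall t, exists p : 'S_k, order_event p t}.
Proof.
have W01 : {ae power_measure P k, forall t, forall i j : 'I_k, i != j ->
    W (tnth t i, tnth t j) = 0 \/ W (tnth t i, tnth t j) = 1}.
  apply: filter_forall => i; apply: filter_forall => j.
  have [->|ij] := eqVneq i j; first exact: aeW.
  by apply: filterS (ae_pair ij transitive_kernel_01).
apply: filterS3 W01 (kernel_antisym_ae k) (transitive_kernel_ae k).
move=> t W01 anti tr.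
pose r i j := W (tnth t i, tnth t j) == 1.
have WE i j : i != j -> W (tnth t i, tnth t j) = (r i j)%:R.
  by rewrite /r => /W01[] ->; rewrite ?eqxx// eq_sym oner_eq0.
have [p rp] : exists p : 'S_k, forall i j, i != j -> r i j = (p i < p j)%N.
  apply: tournament_rank => [i j ij|i j l ijl /eqP rij /eqP rjl].
    have := anti i j ij; rewrite !WE// 1?eq_sym//.
    by case: (r i j); case: (r j i) => //=; rewrite ?mulr1n ?mulr0n; lra.
  by apply/eqP/(tr i j l) => //; rewrite ?rij ?rjl ltr01.
by exists p => i j ij; rewrite WE// rp.
Qed.

(** Reindexing by the inverse of [p] turns the order [p] into the identity order and preserves the
    measure. *)
Lemma power_measure_order_event k (p : 'S_k) :
  power_measure P k (order_event p) = power_measure P k (order_event 1%g).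
Proof.
rewrite -[RHS](@power_measure_reindex _ T R P k k (p^-1)%g).
- congr (power_measure P k _); apply/seteqP; split=> t pt i j ij.
    rewrite !tnth_reindex pt ?(inj_eq perm_inj)// !permKV !perm1//.
  have := pt (p i) (p j); rewrite !tnth_reindex !permK !perm1 (inj_eq perm_inj).
  exact.
- exact: perm_inj.
- exact: measurable_order_event.
Qed.

(** Almost everywhere exactly one order event occurs, and the edge product is [1] if that order
    extends [F] and [0] otherwise. The integrand is thus a sum of indicators of equally likely
    events. *)
Lemma hom_density_order_event k (F : rel 'I_k) : (forall i, ~~ F i i) ->
  hom_density P F W =
  (#|[set p | linear_extension F p]%SET|%:R%:E *
   power_measure P k (order_event 1%g))%E.
Proof.
move=> Firr; set A := [set p | linear_extension F p]%SET.
have mprod : measurable_fun [set: k.-tuple T] (fun t =>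
    (\prod_(e : 'I_k * 'I_k | F e.1 e.2) W (tnth t e.1, tnth t e.2))%:E).
  apply/measurable_EFinP; under eq_fun do rewrite -big_filter.
  apply: measurable_prod => e _.
  exact: measurable_kernel_tnth.
have mind (p : 'S_k) : measurable_fun setT (fun t => (\1_(order_event p) t : R)%:E).
  by apply/measurable_EFinP; apply: measurable_indic; exact: measurable_order_event.
transitivity (\int[power_measure P k]_t
    (\sum_(p <- enum A) (\1_(order_event p) t)%:E))%E; last first.
  rewrite ge0_integral_sum//.
  rewrite (eq_bigr (fun=> power_measure P k (order_event 1%g))); last first.
    move=> p _; rewrite integral_indic// ?setIT; first exact: power_measure_order_event.
    exact: measurable_order_event.
  by rewrite big_enum/= sumr_const mule_natl.
apply: ge0_ae_eq_integral => //.
- exact: emeasurable_sum.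
- by move=> t _; rewrite lee_fin prodr_ge0// => e _; exact: kernel_ge0.
- by move=> t _; apply: sume_ge0 => p _; rewrite lee_fin.
apply: filterS (order_event_ae k) => t [p pt] _.
have ind q : \1_(order_event q) t = (q == p)%:R :> R.
  rewrite indicE; congr ((nat_of_bool _)%:R); apply/idP/eqP => [/set_mem qt|->].
    exact: order_event_inj qt pt.
  exact/mem_set.
under [RHS]eq_bigr do rewrite ind.
rewrite big_enum/= sumEFin; congr (_%:E); have [pA|pA] := boolP (p \in A).
  rewrite [RHS](bigD1 p)//= eqxx [X in _ = _ + X]big1 ?addr0; last first.
    by move=> q /andP[_ /negbTE ->].
  rewrite big1// => -[i j]/= Fij; have ij : i != j.
    by apply: contraTneq Fij => ->.
  by rewrite pt//; move: pA; rewrite inE => /linear_extensionP ->.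
rewrite [RHS]big1 => [|q qA]; last by case: eqP qA pA => // -> ->.
move: pA; rewrite inE => /forallPn[i /forallPn[j]].
rewrite negb_imply => /andP[Fij /negbTE pij]; rewrite (bigD1 (i, j))//=.
by rewrite pt ?pij ?mul0r//; apply: contraTneq Fij => ->.
Qed.

Lemma hom_density_transitive k (F : rel 'I_k) : (forall i, ~~ F i i) ->
  hom_density P F W =
  (#|[set p | linear_extension F p]%SET|%:R / (k`!)%:R)%:E.
Proof.
move=> Firr; rewrite hom_density_order_event//.
(* The edgeless digraph has density [1] and all [k!] permutations as linear extensions, which fixes
   the measure of an order event at [1 / k!]. *)
have : hom_density P (fun _ _ : 'I_k => false) W = 1%E.
  rewrite /hom_density; under eq_integral do rewrite big_pred0//.
  by rewrite integral_cst// mul1e; exact: (probability_setT (power_measure P k)).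
rewrite hom_density_order_event// (_ : [set p | _]%SET = [set: 'S_k]%SET); last first.
  by apply/setP => p; rewrite !inE; apply/linear_extensionP.
rewrite cardsT card_Sn -(fineK (fin_num_measure _ _ (measurable_order_event 1%g))).
move=> [kc]; rewrite -EFinM; congr (_ * _)%:E.
have k0 : (k`!)%:R != 0 :> R by rewrite pnatr_eq0 -lt0n fact_gt0.
by apply: (mulfI k0); rewrite kc divff.
Qed.

End transitive.
End tournament_kernels.

(** * Linear relations between the densities on three vertices *)

Section three_vertices.
Context d (T : measurableType d) (R : realType) (P : probability T R).
Variable W : T * T -> R.
Hypothesis hW : tournament_kernel P W.

Local Notation I3 f := (\int[power_measure P 3]_t (f t)%:E)%E.
Let w i j (t : 3.-tuple T) := W (tnth t i, tnth t j).

Let w_ge0 i j t : 0 <= w i j t. Proof. exact: (kernel_ge0 hW). Qed.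
Let mw i j : measurable_fun [set: 3.-tuple T] (w i j).
Proof. exact: (measurable_kernel_tnth hW). Qed.

Let integralD_ae (f f1 f2 : 3.-tuple T -> R) :
  measurable_fun [set: 3.-tuple T] f -> measurable_fun [set: 3.-tuple T] f1 ->
  measurable_fun [set: 3.-tuple T] f2 ->
  (forall t, 0 <= f t) -> (forall t, 0 <= f1 t) -> (forall t, 0 <= f2 t) ->
  {ae power_measure P 3, forall t, f t = f1 t + f2 t} ->
  I3 f = (I3 f1 + I3 f2)%E.
Proof.
move=> mf mf1 mf2 f0 f10 f20 ff; rewrite -ge0_integralD//; last 4 first.
- by move=> t _; rewrite lee_fin.
- exact/measurable_EFinP.
- by move=> t _; rewrite lee_fin.
- exact/measurable_EFinP.
apply: ge0_ae_eq_integral => //.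
- exact/measurable_EFinP.
- by apply: emeasurable_funD; exact/measurable_EFinP.
- by move=> t _; rewrite lee_fin.
- by move=> t _; rewrite adde_ge0 ?lee_fin.
by apply: filterS ff => t -> _.
Qed.

Lemma prod_edges3 (F : rel 'I_3) (f : 'I_3 * 'I_3 -> R) : (forall i, ~~ F i i) ->
  \prod_(e | F e.1 e.2) f e =
    (if F 0 1 then f (0, 1) else 1) * (if F 0 2 then f (0, 2) else 1) *
    (if F 1 0 then f (1, 0) else 1) * (if F 1 2 then f (1, 2) else 1) *
    (if F 2 0 then f (2, 0) else 1) * (if F 2 1 then f (2, 1) else 1).
Proof.
move=> Firr; rewrite big_mkcond/=.
transitivity (\prod_i \prod_j (if F i j then f (i, j) else 1)).
  by rewrite pair_bigA; apply: eq_bigr => -[].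
have [E1 E2] : lift ord0 ord0 = 1 :> 'I_3 /\ lift ord0 (lift ord0 ord0) = 2 :> 'I_3.
  by split; exact/val_inj.
rewrite !big_ord_recl !big_ord0 !E2 !E1 /= !(negbTE (Firr _)).
by rewrite !mulr1 !mul1r !mulrA.
Qed.

Let cycle3E : hom_density P (@cycle_graph 3) W =
  I3 (fun t => w 0 1 t * w 1 2 t * w 2 0 t).
Proof.
apply: eq_integral => t _; rewrite prod_edges3//; last by case=> -[|[|[|]]].
by rewrite /= !mulr1.
Qed.

Let path3E : hom_density P (@path_graph 3) W = I3 (fun t => w 0 1 t * w 1 2 t).
Proof.
apply: eq_integral => t _; rewrite prod_edges3//; last by case=> -[|[|[|]]].
by rewrite /= !mulr1.
Qed.

Let transitive3E : hom_density P (@transitive_tournament 3) W =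
  I3 (fun t => w 0 1 t * w 0 2 t * w 1 2 t).
Proof.
apply: eq_integral => t _; rewrite prod_edges3//; last by case=> -[|[|[|]]].
by rewrite /= !mulr1.
Qed.

Let outdegreeE : (\int[P]_x ((\int[P]_y (W (x, y))%:E) ^+ 2) =
  I3 (fun t => w 0 1 t * w 0 2 t))%E.
Proof.
apply: integral_sqr; first exact: tournament_kernel_measurable hW.
exact: (kernel_ge0 hW).
Qed.

Let wD : {ae power_measure P 3, forall t, forall i j, i != j ->
  w i j t + w j i t = 1}.
Proof. exact: kernel_antisym_ae. Qed.

(** Of the two orientations of the missing edge between [0] and [2], one completes the path to a
    transitive tournament, the other to a cycle. *)
Lemma path3_decomposition : hom_density P (@path_graph 3) W =
  (hom_density P (@transitive_tournament 3) W +
   hom_density P (@cycle_graph 3) W)%E.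
Proof.
rewrite path3E transitive3E cycle3E; apply: integralD_ae; first 3 last.
- by move=> t; rewrite mulr_ge0.
- by move=> t; rewrite !mulr_ge0.
- by move=> t; rewrite !mulr_ge0.
- apply: filterS wD => t /(_ 0 2 isT) wt.
  by rewrite mulrAC -mulrDr wt mulr1.
- exact: measurable_funM.
- by do 2 apply: measurable_funM => //.
- by do 2 apply: measurable_funM => //.
Qed.

(** The squared out-degree is the density of the star with edges from [0] to [1] and [2]; either
    orientation of the missing edge gives a transitive tournament. *)
Lemma outdegree_sqr_transitive3 :
  (\int[P]_x ((\int[P]_y (W (x, y))%:E) ^+ 2) =
   hom_density P (@transitive_tournament 3) W +
   hom_density P (@transitive_tournament 3) W)%E.
Proof.
rewrite outdegreeE {1}transitive3E.
have -> : hom_density P (@transitive_tournament 3) W =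
    I3 (fun t => w 0 1 t * w 0 2 t * w 2 1 t).
  (* Exchanging [1] and [2] maps one completion of the star to the other. *)
  pose h (a : 'I_3) := tnth [tuple 0; 2; 1] a : 'I_3.
  rewrite transitive3E.
  rewrite -(@ge0_integral_reindex _ _ _ _ _ 3 h); first last.
  - by move=> t; rewrite lee_fin !mulr_ge0.
  - by apply/measurable_EFinP; do 2 apply: measurable_funM => //.
  - exact/tuple_uniqP.
  apply: eq_integral => t _; rewrite /w !tnth_reindex.
  by congr (_%:E); rewrite [X in X * _ = _]mulrC.
apply: integralD_ae; first 3 last.
- by move=> t; rewrite mulr_ge0.
- by move=> t; rewrite !mulr_ge0.
- by move=> t; rewrite !mulr_ge0.
- apply: filterS wD => t /(_ 1 2 isT) wt.
  by rewrite -mulrDr wt mulr1.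
- exact: measurable_funM.
- by do 2 apply: measurable_funM => //.
- by do 2 apply: measurable_funM => //.
Qed.

(** With its middle vertex relabelled [0], the path differs from the out-star only in the direction
    of the edge between [0] and [1]. The sum is therefore the density of a single edge. *)
Lemma path3_outdegree_sqr :
  (hom_density P (@path_graph 3) W +
   \int[P]_x ((\int[P]_y (W (x, y))%:E) ^+ 2) = (2%:R^-1)%:E)%E.
Proof.
rewrite outdegreeE.
have -> : hom_density P (@path_graph 3) W = I3 (fun t => w 1 0 t * w 0 2 t).
  pose h (a : 'I_3) := tnth [tuple 1; 0; 2] a : 'I_3.
  rewrite path3E -(@ge0_integral_reindex _ _ _ _ _ 3 h); first last.
  - by move=> t; rewrite lee_fin !mulr_ge0.
  - by apply/measurable_EFinP; apply: measurable_funM => //.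
  - exact/tuple_uniqP.
  by apply: eq_integral => t _; rewrite /w !tnth_reindex.
rewrite -(@integralD_ae (w 0 2)); first last.
- apply: filterS wD => t /(_ 1 0 isT) wt.
  by rewrite -mulrDl wt mul1r.
- by move=> t; rewrite mulr_ge0.
- by move=> t; rewrite !mulr_ge0.
- by [].
- exact: measurable_funM.
- exact: measurable_funM.
- by [].
have : (I3 (w 0 2) + I3 (w 2 0) = 1)%E.
  rewrite -(@integralD_ae (fun=> 1))//.
    by rewrite integral_cst// mul1e; exact: (probability_setT (power_measure P 3)).
  by apply: filterS wD => t /(_ 0 2 isT).
(* Exchanging [0] and [2] shows that both directions of an edge have the same integral, hence
   [1/2]. *)
have <- : I3 (w 0 2) = I3 (w 2 0).
  pose h (a : 'I_3) := tnth [tuple 2; 1; 0] a : 'I_3.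
  rewrite -(@ge0_integral_reindex _ _ _ _ _ 3 h); first last.
  - by move=> t; rewrite lee_fin.
  - by apply/measurable_EFinP.
  - exact/tuple_uniqP.
  by apply: eq_integral => t _; rewrite /w !tnth_reindex.
case: (I3 _) => [a| |]//= [aa]; congr (_%:E); lra.
Qed.

Lemma hom_density_ge0 k (F : rel 'I_k) : (0 <= hom_density P F W)%E.
Proof.
apply: integral_ge0 => t _; rewrite lee_fin; apply: prodr_ge0 => e _.
exact: (kernel_ge0 hW).
Qed.

(** If [a] and [c] are the densities of the transitive tournament and the cycle, the relations give
    [(a + c) + 2 a = 1/2]. All four quantities are affine in [c] with nonzero slope, so each
    prescribed value forces [c = 0]. *)
Lemma three_vertex_densities : exists c : R,
  [/\ hom_density P (@cycle_graph 3) W = c%:E,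
      hom_density P (@path_graph 3) W = (6%:R^-1 + 2 / 3 * c)%:E,
      hom_density P (@transitive_tournament 3) W = (6%:R^-1 - c / 3)%:E &
      (\int[P]_x ((\int[P]_y (W (x, y))%:E) ^+ 2) =
        (3%:R^-1 - 2 / 3 * c)%:E)%E].
Proof.
have := path3_outdegree_sqr; rewrite outdegree_sqr_transitive3 path3_decomposition.
have := hom_density_ge0 (@cycle_graph 3).
have := hom_density_ge0 (@transitive_tournament 3).
(* Nonnegativity excludes [-oo], and the finite total excludes [+oo]. *)
case: (hom_density P (@transitive_tournament 3) W) => [a| |]//;
  case: (hom_density P (@cycle_graph 3) W) => [c| |]// _ _ [E].
by exists c; split=> //; congr (_%:E); lra.
Qed.

(** Almost everywhere a factor of the cycle product vanishes. If the first two are positive it is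
    [W (z, x)], so [W (x, z) = 1]. *)
Lemma cycle3_transitive :
  hom_density P (@cycle_graph 3) W = 0%E -> transitive_kernel P W.
Proof.
rewrite cycle3E => /ge0_integral_eq0P.
have mc : measurable_fun [set: 3.-tuple T] (fun t => (w 0 1 t * w 1 2 t * w 2 0 t)%:E).
  by apply/measurable_EFinP; do 2 apply: measurable_funM => //.
have c0 t : (0 <= (w 0 1 t * w 1 2 t * w 2 0 t)%:E)%E.
  by rewrite lee_fin !mulr_ge0.
move=> /(_ mc c0) ww; apply: filterS2 wD ww => t /(_ 0 2 isT) wt [/eqP].
rewrite /= !mulf_eq0 -!orbA => /or3P[/eqP w0 w0'|/eqP w0 _ w0'|/eqP w0 _ _].
- by rewrite -[W _]/(w 0 1 t) w0 ltxx in w0'.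
- by rewrite -[W _]/(w 1 2 t) w0 ltxx in w0'.
- by rewrite -wt w0 addr0.
Qed.

End three_vertices.

(** * The standard kernel on the unit interval *)

Section standard_kernel.
Context (R : realType).

Lemma measurable_unit_val : measurable_fun setT
  (@unit_val R : borel_unit_interval R -> measurableTypeR R).
Proof. by move=> _ B mB; exists B. Qed.

(** Antisymmetry fails only on the diagonal, where the sum is [2]; the diagonal is null because its
    sections are single points. *)
Lemma tournament_kernel_WT : tournament_kernel (@lebesgue_unit R) (@kernel_WT R).
Proof.
have m1 : measurable_fun [set: borel_unit_interval R * borel_unit_interval R]
    (fun p => unit_val p.1 : measurableTypeR R).
  exact: (measurableT_comp measurable_unit_val measurable_fst).
have m2 : measurable_fun [set: borel_unit_interval R * borel_unit_interval R]
    (fun p => unit_val p.2 : measurableTypeR R).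
  exact: (measurableT_comp measurable_unit_val measurable_snd).
split.
- apply: (@measurableT_comp _ _ _ _ _ _ (fun b : bool => b%:R : R)) => //.
  exact: measurable_fun_ler.
- by move=> p; rewrite /kernel_WT ler0n lern1 leq_b1.
exists [set p | unit_val p.1 == unit_val p.2]; split.
- rewrite -[X in measurable X]setTI.
  exact: (measurable_fun_eqr m1 m2 measurableT (Y := [set true])).
- rewrite /= /product_measure1 integral0_eq// => x _ /=.
  rewrite (_ : xsection _ x = [set x]).
    by rewrite /lebesgue_unit image_set1 lebesgue_measure_set1.
  apply/seteqP; split=> [y /xsectionP/= /eqP/unit_val_inj ->//|y ->].
  by apply/xsectionP => /=; rewrite eqxx.
move=> [x y] /=; rewrite /kernel_WT /=; case: ltgtP => //.
- by rewrite addr0.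
- by rewrite add0r.
Qed.

Lemma transitive_kernel_WT : transitive_kernel (@lebesgue_unit R) (@kernel_WT R).
Proof.
apply: aeW => t /=; rewrite /kernel_WT /= !lt0r !pnatr_eq0 !eqb0 !negbK.
by move=> /andP[xy _] /andP[yz _]; rewrite (le_trans xy yz).
Qed.

End standard_kernel.

Theorem theorem5p4 (R : realType) (d : measure_display) (T : measurableType d)
    (P : probability T R) (W : T * T -> R) (hW : tournament_kernel P W) :
  [<-> transitive_kernel P W ;
       acyclic_kernel P W ;
       hom_density P (@cycle_graph 3) W = 0%E ;
       equivalent_kernels P W (@lebesgue_unit R) (@kernel_WT R) ;
       (\int[P]_x ((\int[P]_y (W (x, y))%:E) ^+ 2) = (3%:R^-1)%:E)%E ;
       forall k, (1 <= k)%N ->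
         hom_density P (@path_graph k) W = ((k`!)%:R^-1)%:E ;
       hom_density P (@path_graph 3) W = (6%:R^-1)%:E ;
       forall k, (1 <= k)%N ->
         hom_density P (@transitive_tournament k) W = ((k`!)%:R^-1)%:E ;
       hom_density P (@transitive_tournament 3) W = (6%:R^-1)%:E ].
Proof.
(* Stated for an arbitrary kernel, as it is applied both to [W] and to [kernel_WT]. *)
have cycle0 d' (T' : measurableType d') (P' : probability T' R) W' k :
    tournament_kernel P' W' -> transitive_kernel P' W' -> (3 <= k)%N ->
    hom_density P' (@cycle_graph k) W' = 0%E.
  move=> hW' tr k3; rewrite (hom_density_transitive hW' tr).
    rewrite (eq_card0 (A := _)) ?mul0r// => p.
    by rewrite inE linear_extension_cycleF// (leq_trans _ k3).
  (* There are no loops: the successor of [i] is [i.+1], or [0] when [i] is the last vertex. *)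
  move=> i; rewrite /cycle_graph -val_eqE /=; case: (ltnP i.+1 k) => ik.
    by rewrite modn_small// neq_ltn ltnSn.
  have -> : i.+1 = k by apply/eqP; rewrite eqn_leq ik ltn_ord.
  rewrite modnn; lia.
have [c [cycleE pathE transE sqrE]] := three_vertex_densities hW.
have c0P : hom_density P (@cycle_graph 3) W = 0%E -> transitive_kernel P W.
  exact: cycle3_transitive.
have trc : c = 0 -> transitive_kernel P W.
  by move=> c0; apply: c0P; rewrite cycleE c0.
tfae.
- by move=> tr k; exact: cycle0.
- exact.
(* Both kernels are transitive, and the density formula depends on [F] alone. *)
- move=> /c0P tr k F [Firr _].
  rewrite (hom_density_transitive hW tr)//.
  by rewrite (hom_density_transitive (@tournament_kernel_WT R)
    (@transitive_kernel_WT R)).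
(* Equivalence transfers the vanishing cycle density from [kernel_WT] to [W], so [c = 0]. *)
- move=> eqW; rewrite sqrE; congr (_%:E).
  have : hom_density P (@cycle_graph 3) W = 0%E.
    rewrite eqW; first exact: cycle0 (@tournament_kernel_WT R)
      (@transitive_kernel_WT R) _.
    by split; [case=> -[|[|[|]]]|case=> -[|[|[|//]]] ? [] [|[|[|]]]].
  by rewrite cycleE => -[->]; rewrite mulr0 subr0.
- rewrite sqrE => -[E]; have tr : transitive_kernel P W by apply: trc; lra.
  move=> k k0; rewrite (hom_density_transitive hW tr).
    rewrite card_linear_extension_succ ?mul1r//.
      by move=> i j; rewrite /path_graph => ->.
    by move=> i j /eqP ->.
  by move=> i; rewrite /path_graph neq_ltn ltnSn.
- by move=> /(_ 3%N isT).
- rewrite pathE => -[E]; have tr : transitive_kernel P W by apply: trc; lra.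
  move=> k k0; rewrite (hom_density_transitive hW tr).
    rewrite card_linear_extension_succ ?mul1r//.
    by move=> i j; rewrite /transitive_tournament => ->.
  by move=> i; rewrite /transitive_tournament ltnn.
- by move=> /(_ 3%N isT).
- by rewrite transE => -[E]; apply: trc; lra.
Qed.
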